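(* Let $(S,\cdot,\ast)$ be a regular $\star$-semigroup. Define binary operations $+$ and $\oplus$ on $S$ by $a+b=a^\ast b$ and $a\oplus b=b^\ast a$ for all $a,b\in S$. Then the map associated to $(S,+,\cdot,\ast)$ is a solution of the Yang-Baxter equation if and only if $(S,\cdot,\ast)$ is completely regular, orthodox and locally inverse. Likewise, the map associated to $(S,\oplus,\cdot,\ast)$ is a solution of the Yang-Baxter equation if and only if $(S,\cdot,\ast)$ is completely regular, orthodox and locally inverse.
   Context: A regular $\star$-semigroup is a triple $(S,\cdot,\ast)$ where $(S,\cdot)$ is a semigroup on a non-empty set and $\ast:S\to S$, $x\mapsto x^\ast$, satisfies $xx^\ast x=x$, $(x^\ast)^\ast=x$, $(xy)^\ast=y^\ast x^\ast$ for all $x,y\in S$. It is called completely regular if $a\,\mathcal H\,a^2$ for all $a\in S$ ($\mathcal H=\mathcal L\cap\mathcal R$ being Green's relation), orthodox if the product of any two idempotents is idempotent, and locally inverse if $eSe$ is an inverse semigroup for every idempotent $e$. For a set $S$ with binary operations $+,\cdot$ ($+$ not necessarily associative) and a unary operation $\ast$, the map associated to $(S,+,\cdot,\ast)$ is $r_S:S\times S\to S\times S$, $r_S(a,b)=(a(a^{\ast}+b),\,(a^{\ast}+b)^{\ast}b)$; similarly with $\oplus$ in place of $+$. A map $r:S\times S\to S\times S$ is a (set-theoretic) solution of the Yang-Baxter equation if $(r\times \mathrm{id}_S)(\mathrm{id}_S\times r)(r\times \mathrm{id}_S)=(\mathrm{id}_S\times r)(r\times \mathrm{id}_S)(\mathrm{id}_S\times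 r)$ as maps $S^3\to S^3$. *)

(* Defs.v *)
From mathcomp Require Import all_boot.

Set Implicit Arguments.
Unset Strict Implicit.
Unset Printing Implicit Defensive.

Section Semigroups.

Variables (S : Type) (mul : S -> S -> S).
Local Notation "x * y" := (mul x y).

Definition idempotent_elt (e : S) : Prop := e * e = e.

(* S^1 a and a S^1, where S^1 is S with an identity adjoined if needed. *)
Definition left_ideal (a x : S) : Prop := x = a \/ exists s, x = s * a.
Definition right_ideal (a x : S) : Prop := x = a \/ exists s, x = a * s.

Definition greenL (a b : S) : Prop :=
  forall x, left_ideal a x <-> left_ideal b x.
Definition greenR (a b : S) : Prop :=
  forall x, right_ideal a x <-> right_ideal b x.
Definition greenH (a b : S) : Prop := greenL a b /\ greenR a b.

Definition completely_regular : Prop := forall a, greenH a (a * a).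

Definition orthodox : Prop :=
  forall e f, idempotent_elt e -> idempotent_elt f -> idempotent_elt (e * f).

(* The subset A, under the restriction of the product, is an inverse
   semigroup: each element has a unique inverse within A. *)
Definition inverse_subsemigroup (A : S -> Prop) : Prop :=
  (forall x y, A x -> A y -> A (x * y)) /\
  (forall x, A x -> exists! y, [/\ A y, x * y * x = x & y * x * y = y]).

Definition local_subsemigroup (e x : S) : Prop := exists s, x = e * s * e.

Definition locally_inverse : Prop :=
  forall e, idempotent_elt e -> inverse_subsemigroup (local_subsemigroup e).

Record regular_star_semigroup (star : S -> S) : Prop := RegularStarSemigroup {
  rss_inhabited : inhabited S;
  rss_mulA : associative mul;
  rss_regular : forall x, x * star x * x = x;
  rss_starK : involutive star;
  rss_starM : forall x y, star (x * y) = star y * star x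
}.

End Semigroups.

Definition associated_map (S : Type) (add mul : S -> S -> S) (star : S -> S)
    (p : S * S) : S * S :=
  let: (a, b) := p in (mul a (add (star a) b), mul (star (add (star a) b)) b).

Section YangBaxter.

Variables (S : Type) (r : S * S -> S * S).

Definition r_id (t : S * S * S) : S * S * S :=
  let: (a, b, c) := t in let: (u, v) := r (a, b) in (u, v, c).

Definition id_r (t : S * S * S) : S * S * S :=
  let: (a, b, c) := t in let: (u, v) := r (b, c) in (a, u, v).

Definition yang_baxter : Prop := r_id \o id_r \o r_id =1 id_r \o r_id \o id_r.

End YangBaxter.

(* Main.v *)
(* Write x' for the star of x.  The two associated maps are (a,b) |-> (aab, b'a'b)
   and (a,b) |-> (ab'a', abb); they are conjugate under (a,b) |-> (b',a'), so only
   the first one, r, matters.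
   If r is a solution, the third coordinate at c = b' gives b in bbS, that is,
   complete regularity, and with b a product of two projections it gives
   sqpqs = spqps for all projections.  Hence projections below a common
   projection commute, which yields local inversity, and together with complete
   regularity pqrqp = pqprp.  The first coordinate then reduces to pqr = pqpr, so
   products of projections, and a fortiori of idempotents, are idempotent.
   Conversely, orthodoxy and local inversity give efgh = egfh for idempotents;
   with complete regularity S behaves between any two outer factors as a Clifford
   semigroup, where the three coordinate identities follow by cancellation. *)

Require Import Defs.
From mathcomp Require Import all_boot.
From Stdlib Require Import Setoid Morphisms.

Set Implicit Arguments.
Unset Strict Implicit.
Unset Printing Implicit Defensive.

(** Reversing a triple and applying [phi] to each entry is an involution that exchanges [r_id] with
    [id_r], hence the two sides of the equation. *)
Lemma yang_baxter_flip (S : Type) (phi : S -> S) (r r' : S * S -> S * S) :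
  involutive phi ->
  (forall a b, r' (a, b) = (phi (r (phi b, phi a)).2, phi (r (phi b, phi a)).1)) ->
  yang_baxter r -> yang_baxter r'.
Proof.
move=> phiK r'E ybr.
pose flip (t : S * S * S) := (phi t.2, phi t.1.2, phi t.1.1).
have flipK t : flip (flip t) = t by case: t => [[a b] c]; rewrite /flip /= !phiK.
have r_idE t : r_id r' t = flip (id_r r (flip t)).
  by case: t => [[a b] c]; rewrite /= r'E; case: (r _) => u v; rewrite /flip /= phiK.
have id_rE t : id_r r' t = flip (r_id r (flip t)).
  by case: t => [[a b] c]; rewrite /= r'E; case: (r _) => u v; rewrite /flip /= phiK.
move=> t; rewrite /= !r_idE !id_rE !flipK; congr flip.
exact: (esym (ybr (flip t))).
Qed.

(** * Projections and idempotents *)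

Section RegularStarSemigroup.

Variables (S : Type) (mul : S -> S -> S) (star : S -> S).
Hypothesis hS : regular_star_semigroup mul star.

Local Notation "x * y" := (mul x y).
Local Notation "x ^*" := (star x).

Let mulA : associative mul. Proof. by case: hS. Qed.
Let regular x : x * x^* * x = x. Proof. by case: hS. Qed.
Let starK : involutive star. Proof. by case: hS. Qed.
Let starM x y : (x * y)^* = y^* * x^*. Proof. by case: hS. Qed.

Let regularV x : x^* * x * x^* = x^*.
Proof. by rewrite -{2}(starK x) regular. Qed.

Definition projection (p : S) : Prop := p * p = p /\ p^* = p.

Lemma projection_mul_star x : projection (x * x^*).
Proof. by split; rewrite ?starM ?starK // mulA regular. Qed.

Lemma projection_idem p : projection p -> p * p = p.
Proof. by case. Qed.

Lemma projection_star p : projection p -> p^* = p.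
Proof. by case. Qed.

(** Regularity of [p * q] reads [p * q * q * p * p * q = p * q], which collapses to the claim. *)
Lemma projection_mul_idem p q : projection p -> projection q -> idempotent_elt mul (p * q).
Proof.
move=> [pp ps] [qq qs]; rewrite /idempotent_elt -{3}(regular (p * q)) starM ps qs.
by rewrite !mulA -(mulA p q q) qq -(mulA (p * q) p p) pp.
Qed.

Lemma projection_absorb x p : projection p -> x * p * p = x * p.
Proof. by move=> [pp _]; rewrite -mulA pp. Qed.

Lemma projection_absorb2 x p q : projection p -> projection q ->
  x * p * q * p * q = x * p * q.
Proof.
move=> hp hq; have := projection_mul_idem hp hq.
by rewrite /idempotent_elt -!mulA => ->.
Qed.

Lemma projection_alt p q : projection p -> projection q -> p * q * p * q = p * q.
Proof. by move=> hp hq; rewrite -(mulA (p * q)) projection_mul_idem. Qed.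

Lemma projection_conj p q : projection p -> projection q -> projection (p * q * p).
Proof.
move=> hp hq; have [[pp ps] [qq qs]] := (hp, hq).
split; last by rewrite !starM ps qs mulA.
rewrite !mulA (projection_absorb _ hp) -{1}pp.
by rewrite (projection_absorb2 _ hp hq) pp.
Qed.

Lemma idempotent_star e : idempotent_elt mul e -> idempotent_elt mul e^*.
Proof. by rewrite /idempotent_elt -starM => ->. Qed.

Lemma idempotent_factor e : idempotent_elt mul e -> e = (e * e^*) * (e^* * e).
Proof.
move=> ee; have es := idempotent_star ee.
by rewrite mulA -(mulA e) es regular.
Qed.

Lemma idempotent_projections e : idempotent_elt mul e ->
  exists p q, [/\ projection p, projection q & e = p * q].
Proof.
move=> ee; exists (e * e^*), (e^* * e); split; last exact: idempotent_factor.
- exact: projection_mul_star.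
- by rewrite -{2}(starK e); apply: projection_mul_star.
Qed.

Lemma completely_regularP : completely_regular mul <-> forall a, exists t, a = a * a * t.
Proof.
split=> [cr a | cr a].
  have [_ /(_ a) [/(_ (or_introl erefl)) haa _]] := cr a.
  by case: haa => [aE | [t aE]]; [exists a; rewrite -!aE | exists t].
split=> x; split.
- have [t /(congr1 star)] := cr a^*; rewrite !starM !starK mulA => aE.
  by case=> [->|[s ->]]; right; [exists t^* | exists (s * t^*)]; rewrite {1}aE !mulA.
- by case=> [->|[s ->]]; right; [exists a | exists (s * a); rewrite mulA].
- have [t aE] := cr a.
  by case=> [->|[s ->]]; right; [exists t | exists (t * s); rewrite {1}aE !mulA].
- by case=> [->|[s ->]]; right; [exists a | exists (a * s); rewrite mulA].
Qed.

(** * The three coordinates of the Yang-Baxter equation for [+] *)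

Definition yb_first : Prop := forall a b c,
  a * a * b * a * a * b * b^* * a^* * b * b^* * a^* * b * c = a * a * b * b * c.

Definition yb_second : Prop := forall a b c,
  c^* * b^* * a * b * b^* * a * b * b^* * a^* * a^*
    * b^* * a^* * b * b^* * a^* * b * c =
  c^* * b^* * b^* * a^* * b * b * c * c^* * b^* * b^* * a^* * b * b * c * c^* * b^* * c.

Definition yb_third : Prop := forall a b c,
  c^* * b^* * a * b * c =
  c^* * b * c * c^* * b^* * b^* * a * b * b * c * c^* * b^* * c.

Lemma yang_baxter_words (add : S -> S -> S) : (forall a b, add a b = a^* * b) ->
  yang_baxter (associated_map add mul star) <-> [/\ yb_first, yb_second & yb_third].
Proof.
move=> addE; split=> [yb | [e1 e2 e3] [[a b] c]].
  by split=> a b c; case: (yb (a, b, c));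
    rewrite !addE !starM !starK !mulA.
rewrite /= !addE !starM !starK !mulA.
by rewrite e1 e2 e3.
Qed.

(** * From a solution to the three structural properties *)

Section SolutionImplies.

Hypotheses (yb1 : yb_first) (yb3 : yb_third).

Lemma yb_completely_regular : completely_regular mul.
Proof.
apply/completely_regularP => b.
(* The choice [a = b * b^*] collapses the left side to [b * b^*], while the right side begins with
   [b * b]. *)
have := yb3 (b * b^*) b b^*; rewrite starK !mulA !regular => /(congr1 (mul^~ b)).
by rewrite regular -!mulA => h; eexists; rewrite -mulA; exact: h.
Qed.

(** Each side is some [w * w^*], with [w = s * q * p] or [w = s * p * q], and the third coordinate
    puts it in the right ideal of the other [w]. So each side fixes the other, and taking stars
    makes them equal. *)
Lemma yb_conj_sym s p q : projection s -> projection p -> projection q ->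
  s * q * p * q * s = s * p * q * p * s.
Proof.
move=> hs hp hq.
have key u v : projection u -> projection v -> exists x, s * v * u * v * s = s * u * v * x.
  move=> hu hv; have := yb3 u (u * v) s.
  rewrite starM !projection_star // !mulA.
  rewrite !(projection_absorb _ hu) => ->.
  by rewrite -!mulA; eexists; rewrite -!mulA; reflexivity.
have conjE u v : projection u -> projection v ->
    s * u * v * u * s = (s * u * v) * (s * u * v)^*.
  by move=> hu hv; rewrite !starM !projection_star // !mulA -(mulA _ v v) projection_idem.
have le u v : projection u -> projection v ->
    (s * u * v * u * s) * (s * v * u * v * s) = s * v * u * v * s.
  move=> hu hv; have [x ->] := key u v hu hv.
  by rewrite conjE // mulA regular.
rewrite -(le p q) // -[RHS](le q p) // -[RHS]projection_star; last first.
  rewrite le // conjE //; exact: projection_mul_star.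
by rewrite !(conjE, starM, starK).
Qed.

(** Under [s], [yb_conj_sym] reads [u * v * u = v * u * v]; idempotency of [u * v] and [v * u] makes
    both equal to that element. *)
Lemma yb_projections_comm s u v : projection s -> projection u -> projection v ->
  s * u = u -> s * v = v -> u * v = v * u.
Proof.
move=> hs hu hv su sv.
have us : u * s = u by rewrite -(projection_star hu) -{1}(projection_star hs) -starM su.
have vs : v * s = v by rewrite -(projection_star hv) -{1}(projection_star hs) -starM sv.
have := yb_conj_sym hs hu hv; rewrite su sv -!mulA us vs !mulA => h.
have uv := projection_mul_idem hu hv; have vu := projection_mul_idem hv hu.
rewrite -uv -[RHS]vu !mulA -h.
by rewrite -(mulA _ v v) projection_idem // h -(mulA _ u u) projection_idem // -h.
Qed.

(** With [u = p * q * p] and [v = p * r * p], which commute, the left side [z] satisfies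
    [z * u = z * v = z], hence [z * (u * v) = z]. Complete regularity gives
    [z * (u * v) = u * v]. *)
Lemma yb_conj_mul p q r : projection p -> projection q -> projection r ->
  p * q * r * q * p = p * q * p * r * p.
Proof.
move=> hp hq hr.
have hu := projection_conj hp hq; have hv := projection_conj hp hr.
have le w : p * (p * w * p) = p * w * p by rewrite !mulA projection_idem.
have comm := yb_projections_comm hp hu hv (le _) (le _).
have wE : p * q * p * r * p = p * r * p * q * p.
  by have := comm; rewrite !mulA !(projection_absorb _ hp).
set z := p * q * r * q * p.
have zE : z = p * r * q * r * p by apply: yb_conj_sym.
have zu : z * (p * q * p) = z.
  by rewrite /z !mulA (projection_absorb _ hp) (projection_absorb2 _ hq hp).
have zv : z * (p * r * p) = z.
  by rewrite zE !mulA (projection_absorb _ hp) (projection_absorb2 _ hr hp).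
(* This makes [p * r * p * q] a right multiple of [p * r * p * q * r], which [z] fixes. *)
have [t tE] := (completely_regularP.1 yb_completely_regular) (r * p * q).
have zx : z * (p * r * p * q * r) = p * r * p * q * r.
  have -> : z = p * r * p * q * r * (p * r * p * q * r)^*.
    have := yb_conj_sym hv hq hr; rewrite !starM !projection_star // !mulA zE.
    rewrite (projection_absorb _ hr) (projection_alt hp hr) (projection_absorb2 _ hr hp).
    by rewrite -!mulA.
  exact: regular.
have zprpq : z * (p * r * p * q) = p * r * p * q.
  have -> : p * r * p * q = p * r * p * q * r * (p * q * t).
    by have := congr1 (mul p) tE; rewrite !mulA.
  by rewrite mulA zx.
have zw : z * (p * q * p * r * p) = z.
  by rewrite -{2}zv -{2}zu !mulA (projection_absorb _ hp).
by rewrite -zw wE mulA zprpq.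
Qed.

(** At [(p * q, r, r)] the right side of the first coordinate is [p * q * r], and repeated use of
    [yb_conj_mul] shrinks the left side to [p * q * p * r]. *)
Lemma yb_mul3 p q r : projection p -> projection q -> projection r ->
  p * q * r = p * q * p * r.
Proof.
move=> hp hq hr.
have le : p * q * p * r * q * p = p * r * q * p.
  have TT : p * r * q * p * (p * r * q * p)^* = p * q * p * r * p.
    rewrite !starM !projection_star // !mulA (projection_absorb _ hp).
    have := yb_conj_mul hp hr (projection_conj hq hp); rewrite !mulA => ->.
    rewrite (projection_absorb2 _ hp hq) -(yb_conj_mul hp hr hq) -(yb_conj_mul hp hq hr).
    exact: yb_conj_sym.
  have T_eq : p * q * p * (p * r * q * p) = p * r * q * p.
    rewrite -(regular (p * r * q * p)) TT !mulA !(projection_absorb _ hp).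
    by rewrite (projection_alt hp hq).
  by move: T_eq; rewrite !mulA (projection_absorb _ hp).
have := yb1 (p * q) r r; rewrite starM !projection_star // !mulA.
rewrite !(projection_absorb _ hr) (projection_alt hp hq) (projection_absorb2 _ hp hq).
have -> : p * q * r * p * q * r * q * p * r * q * p * r
        = p * q * r * (p * q * r * q * p) * r * q * p * r by rewrite !mulA.
rewrite (yb_conj_mul hp hq hr) !mulA (projection_absorb2 _ hp hr).
have -> : p * q * r * p * q * p * r * q * p * r
        = p * q * r * (p * q * p * r * q * p) * r by rewrite !mulA.
rewrite le => {1}<-.
have := yb_conj_mul hp hq (projection_conj hr hp); rewrite !mulA => ->.
by rewrite !(projection_absorb2 _ hp hr).
Qed.

(** [yb_mul3] turns [p * q * r] into the product of the two projections [p * q * p] and [r]; two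
    rounds bring the four projections behind [e * f] down to two. *)
Lemma yb_orthodox : orthodox mul.
Proof.
have mul3 p q r : projection p -> projection q -> projection r ->
    idempotent_elt mul (p * q * r).
  move=> hp hq hr; rewrite yb_mul3 //.
  exact: projection_mul_idem (projection_conj hp hq) hr.
move=> e f /idempotent_projections [p [q [hp hq ->]]] /idempotent_projections [r [s [hr hs ->]]].
rewrite mulA (yb_mul3 hp hq hr); apply: mul3 => //; exact: projection_conj.
Qed.

(** Right multiplication by [e^*] carries [e S e] multiplicatively under the projection
    [s = e * e^*], where the images of idempotents are projections and so commute; multiplying by
    [e] undoes it. *)
Lemma yb_idempotents_comm e f g : idempotent_elt mul f -> idempotent_elt mul g ->
  e * f = f -> f * e = f -> e * g = g -> g * e = g -> f * g = g * f.
Proof.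
move=> ff gg ef fe eg ge; pose s := e * e^*.
have hs : projection s := projection_mul_star e.
have mulE x y : x * e = x -> e * y = y -> x * e^* * (y * e^*) = x * y * e^*.
  by move=> xe ey; rewrite -{1}xe -{1}ey !mulA -(mulA x) -(mulA x) regular xe.
(* Such a [y] is a product of two projections under [s]; these commute, so [y] is its own star. *)
have proj y : idempotent_elt mul y -> s * y = y -> s * y^* = y^* -> projection y.
  move=> yy sy sys; split=> //; have yE := idempotent_factor yy.
  have hu := projection_mul_star y.
  have hv : projection (y^* * y) by rewrite -{2}(starK y); apply: projection_mul_star.
  rewrite [RHS]yE (yb_projections_comm hs hu hv) ?(mulA s) ?sy ?sys //.
  by rewrite {1}yE starM (projection_star hu) (projection_star hv).
have hproj x : idempotent_elt mul x -> e * x = x -> x * e = x ->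
    projection (x * e^*) /\ s * (x * e^*) = x * e^*.
  move=> xx ex xe.
  have sx : s * (x * e^*) = x * e^* by rewrite mulA -{1}ex /s mulA regular ex.
  split=> //; apply: proj => //; first by rewrite /idempotent_elt mulE // xx.
  by rewrite -{1}(projection_star hs) -starM /s -mulA (mulA e^*) regularV.
have [hf sf] := hproj f ff ef fe; have [hg sg] := hproj g gg eg ge.
have := yb_projections_comm hs hf hg sf sg; rewrite !mulE // => /(congr1 (mul^~ e)).
have cancel y : y * e = y -> y * e^* * e = y.
  by move=> ye; rewrite -{1}ye -!mulA (mulA e) regular.
by rewrite !cancel // -mulA ?ge ?fe.
Qed.

Lemma yb_locally_inverse : locally_inverse mul.
Proof.
move=> e ee.
split=> [x y [s ->] [t ->] | x [s xE]].
  by exists (s * e * (e * t)); rewrite !mulA.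
have [ex xe] : e * x = x /\ x * e = x.
  by rewrite xE !mulA ee; split=> //; rewrite -mulA ee.
pose z := e * x^* * e.
have [ez ze] : e * z = z /\ z * e = z by split; rewrite /z ?mulA ?ee // -mulA ee.
have xzx : x * z * x = x by rewrite /z !mulA xe -mulA ex regular.
have zxz : z * x * z = z.
  by rewrite /z !mulA -(mulA _ e x) ex -(mulA _ x e) xe -(mulA e) -(mulA e) regularV.
have Az : local_subsemigroup mul e z by exists x^*.
clearbody z; exists z; split=> // y [[t yE] xyx yxy].
have [ey ye] : e * y = y /\ y * e = y.
  by rewrite yE !mulA ee; split=> //; rewrite -mulA ee.
(* Inverses are unique because idempotents of [e S e] commute. *)
have zx_yx : z * x * (y * x) = y * x * (z * x).
  by apply: (@yb_idempotents_comm e); rewrite /idempotent_elt ?mulA ?zxz ?yxy ?ez ?ey // -mulA xe.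
have xz_xy : x * z * (x * y) = x * y * (x * z).
  by apply: (@yb_idempotents_comm e); rewrite /idempotent_elt ?mulA ?xzx ?xyx ?ex // -mulA ?ze ?ye.
have zxy : z * x * y = y.
  by rewrite -{1}yxy !mulA -(mulA _ y x) zx_yx !mulA -(mulA _ x z) -(mulA _ _ x) xzx yxy.
have xy : x * z = x * y by move: xz_xy; rewrite !mulA xzx xyx.
by rewrite -zxy -mulA -xy mulA zxz.
Qed.

End SolutionImplies.

(** * From the three structural properties to a solution *)

Section NormalOrthogroup.

Hypotheses (cr : completely_regular mul) (orth : orthodox mul)
  (linv : locally_inverse mul).

(* In an orthodox semigroup [e v u e] is an inverse of [e u v e]; as the
   idempotent [e u v e] is also its own inverse in [e S e], the two agree. *)
Lemma idempotent_swap_same e u v : idempotent_elt mul e -> idempotent_elt mul u ->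
  idempotent_elt mul v -> e * u * v * e = e * v * u * e.
Proof.
move=> ee uu vv.
have inv f g : idempotent_elt mul f -> idempotent_elt mul g ->
    e * f * g * e * (e * g * f * e) * (e * f * g * e) = e * f * g * e.
  move=> ff gg.
  have ef := orth ee ff; have ge := orth gg ee.
  have efE : e * f * (f * e * f) = e * f by rewrite !mulA -(mulA e f f) ff -mulA ef.
  have geE : g * e * g * (g * e) = g * e by rewrite !mulA -(mulA _ g g) gg -mulA ge.
  have hab := orth (orth (orth ff ee) ff) (orth (orth gg ee) gg).
  transitivity (e * f * (g * e * g) * (f * e * f) * (g * e)).
    by rewrite !mulA -!(mulA _ e e) ee.
  (* Padding exposes the square of the idempotent [f * e * f * (g * e * g)]. *)
  transitivity (e * f * (f * e * f) * (g * e * g) * (f * e * f) * (g * e * g * (g * e))).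
    by rewrite efE geE.
  transitivity (e * f * (f * e * f * (g * e * g) * (f * e * f * (g * e * g))) * (g * e)).
    by rewrite !mulA.
  rewrite hab (mulA (e * f)) efE -(mulA (e * f)) geE; exact: mulA.
have hx : idempotent_elt mul (e * u * v * e) by do !apply: orth.
have [_ uniq] := linv ee.
have [|y [_ yuniq]] := uniq (e * u * v * e); first by exists (u * v); rewrite !mulA.
rewrite -(yuniq (e * u * v * e)); last first.
  by rewrite hx; split=> //; exists (u * v); rewrite !mulA.
by apply: yuniq; split; [exists (v * u); rewrite !mulA | exact: inv..].
Qed.

(** Squaring [e * f * g * h] puts each pair to be swapped between two copies of [e] or of [h], where
    [idempotent_swap_same] applies. *)
Lemma idempotent_swap e f g h : idempotent_elt mul e -> idempotent_elt mul f ->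
  idempotent_elt mul g -> idempotent_elt mul h -> e * f * g * h = e * g * f * h.
Proof.
move=> ee ff gg hh.
have split_mid x u v : idempotent_elt mul x -> idempotent_elt mul u -> idempotent_elt mul v ->
    x * u * v * x = x * u * x * v * x.
  move=> xx uu vv; rewrite -[in RHS](mulA _ x v) (idempotent_swap_same xx uu (orth xx vv)).
  by rewrite mulA xx; apply: idempotent_swap_same.
have swap x u v w : idempotent_elt mul x -> idempotent_elt mul u -> idempotent_elt mul v ->
    idempotent_elt mul w -> x * u * v * w * x = x * v * u * w * x.
  move=> xx uu vv ww.
  have := split_mid x (u * v) w xx (orth uu vv) ww.
  have := split_mid x (v * u) w xx (orth vv uu) ww.
  by rewrite !mulA (idempotent_swap_same xx uu vv) => -> ->.
have efgh : idempotent_elt mul (e * f * g * h) by do !apply: orth.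
have egfh : idempotent_elt mul (e * g * f * h) by do !apply: orth.
rewrite -efgh !mulA swap //.
have -> : e * g * f * h * e * f * g * h = e * g * f * (h * e * (f * g) * h) by rewrite !mulA.
rewrite (idempotent_swap_same hh ee (orth ff gg)) (mulA h f g) (swap h f g e) //.
rewrite -(mulA h g f) (idempotent_swap_same hh (orth gg ff) ee).
by rewrite -[RHS]egfh !mulA.
Qed.

(* Modulo this congruence [S] is a Clifford semigroup: the idempotents are
   central and [a a^*] equals [a^* a]. *)
Definition mid_eq a b := forall x y, x * a * y = x * b * y.
Local Notation "a ~ b" := (mid_eq a b) (at level 70).

Local Instance mid_eq_equiv : Equivalence mid_eq.
Proof.
by split=> [a x y | a b h x y | a b c h k x y] //; rewrite h ?k.
Qed.

Local Instance mid_eq_mul : Proper (mid_eq ==> mid_eq ==> mid_eq) mul.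
Proof.
by move=> a b h c d k x y; rewrite !mulA k -2!(mulA _ _ y) h !mulA.
Qed.

(** Since [x = x * (x^* * x)] and [y = y * y^* * y], the neighbours of the pair may be taken
    idempotent, as [idempotent_swap] requires. *)
Lemma mid_eq_idem_comm e f : idempotent_elt mul e -> idempotent_elt mul f ->
  e * f ~ f * e.
Proof.
move=> ee ff x y; rewrite -{1 2}(regular x) -{1 2}(regular y).
have xx : idempotent_elt mul (x^* * x) by rewrite /idempotent_elt mulA regularV.
have yy : idempotent_elt mul (y * y^*) by rewrite /idempotent_elt mulA regular.
have := congr1 (fun w => x * w * y) (idempotent_swap xx ee ff yy).
by rewrite !mulA.
Qed.

(** Complete regularity of [a] and [a^*] gives an idempotent [a * t = s * a], neutral for [a] on
    both sides; both products are congruent to it. *)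
Lemma mid_eq_star a : a * a^* ~ a^* * a.
Proof.
have [t aE] := completely_regularP.1 cr a.
have [s' sE] := completely_regularP.1 cr a^*.
pose s := s'^*.
have sa : a = s * (a * a) by rewrite -(starK a) {1}sE !starM starK mulA.
have hE : s * a = a * t by rewrite {1}aE mulA -sa.
have hh : idempotent_elt mul (a * t) by rewrite /idempotent_elt -{1}hE mulA -(mulA s a a) -sa.
have pp : idempotent_elt mul (a * a^*) by rewrite /idempotent_elt mulA regular.
have qq : idempotent_elt mul (a^* * a) by rewrite /idempotent_elt mulA regularV.
transitivity (a * t).
  have -> : a * a^* = a * t * (a * a^*) by rewrite -hE -mulA mulA -mulA [a * (a * _)]mulA mulA -sa.
  rewrite (mid_eq_idem_comm hh pp) mulA regular; reflexivity.
have -> : a^* * a = a^* * a * (a * t) by rewrite mulA -(mulA _ a a) -mulA -aE.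
rewrite (mid_eq_idem_comm qq hh) -hE -mulA (mulA a) regular; reflexivity.
Qed.

(** For [e = a * a^*], the chain is [b * e ~ (b * e) * (b * e)^* * b ~ (b * e)^* * (b * e) * b ~ e *
    b], with [mid_eq_star] for [b * e] in the middle. *)
Lemma mid_eq_central a b : b * (a * a^*) ~ a * a^* * b.
Proof.
have hp := projection_mul_star a; move: (a * a^*) hp => e [ee es].
have qq : idempotent_elt mul (b^* * b) by rewrite /idempotent_elt mulA regularV.
have := mid_eq_star (b * e); rewrite starM es => h.
have -> : b * e = b * (b^* * b * e) by rewrite !mulA regular.
rewrite (mid_eq_idem_comm qq ee).
have -> : b * (e * (b^* * b)) = b * e * (e * b^*) * b by rewrite !mulA -(mulA b e e) ee.
rewrite h.
have -> : e * b^* * (b * e) = e * (b^* * b * e) by rewrite !mulA.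
rewrite (mid_eq_idem_comm qq ee) mulA ee -(mid_eq_star b) -mulA regular; reflexivity.
Qed.

(** Being central, [a * a^*] can travel to another [a] or [a^*] of the word and be absorbed
    there. *)
Lemma mid_cancelr a m : a * m * (a * a^*) ~ a * m.
Proof. by rewrite mid_eq_central !mulA regular. Qed.

Lemma mid_cancelr_star a m : a^* * m * (a * a^*) ~ a^* * m.
Proof. by rewrite mid_eq_central mid_eq_star !mulA regularV. Qed.

Lemma mid_cancell_star a m : a * a^* * m * a^* ~ m * a^*.
Proof. by rewrite -mulA -mid_eq_central -!mulA (mulA a^*) regularV. Qed.

Lemma normal_orthogroup_yb_first : yb_first.
Proof.
move=> a b c.
have h : a * b * a * a * b * b^* * a^* * b * b^* * a^* * b ~ a * b * b.
  transitivity (a * (b * (a * a) * (b * b^*)) * a^* * (b * b^*) * a^* * b).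
    by rewrite !mulA.
  rewrite mid_cancelr.
  transitivity (a * (b * (a * a * a^*) * (b * b^*)) * a^* * b).
    by rewrite !mulA.
  rewrite mid_cancelr.
  transitivity (a * (b * a) * (a * a^*) * a^* * b).
    by rewrite !mulA.
  rewrite mid_cancelr.
  transitivity (a * b * (a * a^*) * b).
    by rewrite !mulA.
  by rewrite mid_cancelr.
by have := h a c; rewrite !mulA.
Qed.

(** Both sides reduce to [c^* * b^* * b^* * a^* * a^* * b * c]. *)
Lemma normal_orthogroup_yb_second : yb_second.
Proof.
move=> a b c.
have l : b^* * a * b * b^* * a * b * b^* * a^* * a^* * b^* * a^* * b * b^* * a^* * b
    ~ b^* * b^* * a^* * a^* * b.
  transitivity (b^* * a * (b * b^*) * a * (b * b^*) * a^* * a^* * b^* * a^* * (b * b^*) * a^* * b).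
    by rewrite !mulA.
  rewrite mid_cancelr_star.
  transitivity (b^* * (a * a) * (b * b^*) * a^* * a^* * b^* * a^* * (b * b^*) * a^* * b).
    by rewrite !mulA.
  rewrite mid_cancelr_star.
  transitivity (b^* * (a * a * a^* * a^* * b^* * a^*) * (b * b^*) * a^* * b).
    by rewrite !mulA.
  rewrite mid_cancelr_star.
  transitivity (b^* * a * (a * a^* * (a^* * b^*) * a^*) * a^* * b).
    by rewrite !mulA.
  rewrite mid_cancell_star.
  transitivity (b^* * (a * a^* * b^* * a^*) * a^* * b).
    by rewrite !mulA.
  by rewrite mid_cancell_star !mulA.
(* The prefix [c * c^*], absorbed by the outer [c^*], supplies inside the congruence the [c^*]
   against which later factors [c * c^*] cancel. *)
have r : c * c^* * b^* * b^* * a^* * b * b * c * c^* * b^* * b^* * a^* * b * b * c * c^* * b^*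
    ~ c * c^* * b^* * b^* * a^* * a^* * b.
  transitivity (c * (c^* * (b^* * b^* * a^* * b * b) * (c * c^*))
                  * b^* * b^* * a^* * b * b * (c * c^*) * b^*).
    by rewrite !mulA.
  rewrite mid_cancelr_star.
  transitivity (c * (c^* * (b^* * b^* * a^* * b * b * b^* * b^* * a^* * b * b) * (c * c^*)) * b^*).
    by rewrite !mulA.
  rewrite mid_cancelr_star.
  transitivity (c * c^* * b^* * (b^* * (a^* * b) * (b * b^*)) * b^* * a^* * b * (b * b^*)).
    by rewrite !mulA.
  rewrite mid_cancelr_star.
  transitivity (c * c^* * b^* * (b^* * a^* * (b * b^*)) * a^* * b * (b * b^*)).
    by rewrite !mulA.
  rewrite mid_cancelr_star.
  transitivity (c * c^* * b^* * (b^* * (a^* * a^* * b) * (b * b^*))).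
    by rewrite !mulA.
  by rewrite mid_cancelr_star !mulA.
by have := l c^* c; have := r c^* c; rewrite !mulA regularV => -> ->.
Qed.

Lemma normal_orthogroup_yb_third : yb_third.
Proof.
move=> a b c.
have h : c * c^* * b * c * c^* * b^* * b^* * a * b * b * c * c^* * b^*
    ~ c * c^* * b^* * a * b.
  transitivity (c * (c^* * b * (c * c^*)) * b^* * b^* * a * b * b * (c * c^*) * b^*).
    by rewrite !mulA.
  rewrite mid_cancelr_star.
  transitivity (c * (c^* * (b * b^* * b^* * a * b * b) * (c * c^*)) * b^*).
    by rewrite !mulA.
  rewrite mid_cancelr_star.
  transitivity (c * c^* * b * b^* * (b^* * (a * b) * (b * b^*))).
    by rewrite !mulA.
  rewrite mid_cancelr_star.
  transitivity (c * c^* * (b * b^* * b^*) * a * b).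
    by rewrite !mulA.
  by rewrite (mid_eq_star b) regularV.
by have := h c^* c; rewrite !mulA regularV => ->.
Qed.

End NormalOrthogroup.

(** * The equivalence for [+] and its transfer to the second operation *)

Lemma yang_baxter_add (add : S -> S -> S) : (forall a b, add a b = a^* * b) ->
  yang_baxter (associated_map add mul star) <->
  completely_regular mul /\ orthodox mul /\ locally_inverse mul.
Proof.
move=> addE; rewrite (yang_baxter_words addE); split=> [[e1 _ e3] | [cr [orth linv]]].
  split; first exact: yb_completely_regular.
  by split; [exact: yb_orthodox | exact: yb_locally_inverse].
split.
- exact: normal_orthogroup_yb_first.
- exact: normal_orthogroup_yb_second.
- exact: normal_orthogroup_yb_third.
Qed.

End RegularStarSemigroup.

Theorem proposition4p4 (S : Type) (mul : S -> S -> S) (star : S -> S)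
    (add oplus : S -> S -> S)
    (hS : regular_star_semigroup mul star)
    (hadd : forall a b : S, add a b = mul (star a) b)
    (hoplus : forall a b : S, oplus a b = mul (star b) a) :
  (yang_baxter (associated_map add mul star) <->
     completely_regular mul /\ orthodox mul /\ locally_inverse mul) /\
  (yang_baxter (associated_map oplus mul star) <->
     completely_regular mul /\ orthodox mul /\ locally_inverse mul).
Proof.
have [_ mulA _ starK starM] := hS.
split; first exact: yang_baxter_add.
rewrite -(yang_baxter_add hS hadd).
split; apply: (yang_baxter_flip starK) => a b;
  by rewrite /= ?hadd ?hoplus ?(starM, starK) ?mulA.
Qed.
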